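(* Let $\mathcal F$ be a finite L-nilpotent family of algebraic operators on a complex vector space $V$, and let $\mathcal A$ be the algebra generated by $\mathcal F$. Then $\mathcal A$ is a finite-dimensional algebra of algebraic operators, its Jacobson radical $J(\mathcal A)$ is nilpotent, and the quotient algebra $\mathcal A/J(\mathcal A)$ is isomorphic to $\mathbb C^n$ for some $n\in\mathbb N$.
   Context: An operator on a complex vector space $V$ is a linear transformation from $V$ into itself. An operator $T$ is algebraic if $p(T)=0$ for some nonzero complex polynomial $p$. Write $[A,B]=AB-BA$. For a family $\mathcal F$ of operators on $V$ put $\mathcal F^{[0]}=\mathcal F$ and $\mathcal F^{[k]}=\{[A,B] : A\in \mathcal F^{[k-1]},\ B\in\mathcal F\}$ for $k=1,2,\ldots$. The family $\mathcal F$ is L-nilpotent if $\mathcal F^{[k]}=\{0\}$ for some $k\in\mathbb N$. The algebra generated by $\mathcal F$ is the smallest associative algebra of operators on $V$ containing $\mathcal F$. The Jacobson radical $J(\mathcal A)$ of an algebra $\mathcal A$ is the intersection of all primitive ideals of $\mathcal A$. A family (in particular, an ideal) of operators is nilpotent if there is $k\in\mathbb N$ such that $T_1T_2\cdots T_k=0$ for every choice of $T_1,\ldots,T_k$ in it. $\mathbb C^n$ carries the coordinatewise algebra operations. *)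

(* Defs.v *)
From HB Require Import structures.
From mathcomp Require Export all_boot all_order all_algebra.
From mathcomp Require Export all_classical all_reals.
From mathcomp Require Export complex.

Set Implicit Arguments.
Unset Strict Implicit.
Unset Printing Implicit Defensive.

Import GRing.Theory.

Local Open Scope ring_scope.
Local Open Scope classical_set_scope.

Definition operator (K : fieldType) (V : lmodType K) : Type := {linear V -> V}.

Section OperatorRing.
Variables (K : fieldType) (V : lmodType K).
Implicit Types S T U : operator V.

Lemma operatorP S T : (forall v, S v = T v) <-> S = T.
Proof.
split=> [ST|-> //].
case: S ST => [s [[sa] [sl]]]; case: T => [t [[ta] [tl]]] /= /funext st.
case: _ / st in ta tl *.
by rewrite (Prop_irrelevance sa ta) (Prop_irrelevance sl tl).
Qed.

HB.instance Definition _ := gen_eqMixin (operator V).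
HB.instance Definition _ := gen_choiceMixin (operator V).

Definition op_zero : operator V := \0 : {linear V -> V}.
Definition op_opp T : operator V := \- (T : {linear V -> V}) : {linear V -> V}.
Definition op_add S T : operator V :=
  (S : {linear V -> V}) \+ (T : {linear V -> V}) : {linear V -> V}.
Definition op_scale c T : operator V :=
  c \*: (T : {linear V -> V}) : {linear V -> V}.
Definition op_one : operator V := idfun : {linear V -> V}.
Definition op_mul S T : operator V :=
  (S : {linear V -> V}) \o (T : {linear V -> V}) : {linear V -> V}.

Fact op_addA : associative op_add.
Proof. by move=> S T U; apply/operatorP => v /=; rewrite addrA. Qed.
Fact op_addC : commutative op_add.
Proof. by move=> S T; apply/operatorP => v /=; rewrite addrC. Qed.
Fact op_add0 : left_id op_zero op_add.
Proof. by move=> S; apply/operatorP => v /=; rewrite add0r. Qed.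
Fact op_addN : left_inverse op_zero op_opp op_add.
Proof. by move=> S; apply/operatorP => v /=; rewrite addNr. Qed.

HB.instance Definition _ :=
  GRing.isZmodule.Build (operator V) op_addA op_addC op_add0 op_addN.

Fact op_scaleA a b T : op_scale a (op_scale b T) = op_scale (a * b) T.
Proof. by apply/operatorP => v /=; rewrite scalerA. Qed.
Fact op_scale1 : left_id 1 op_scale.
Proof. by move=> T; apply/operatorP => v /=; rewrite scale1r. Qed.
Fact op_scaleDr : right_distributive op_scale +%R.
Proof. by move=> a S T; apply/operatorP => v /=; rewrite scalerDr. Qed.
Fact op_scaleDl T : {morph op_scale^~ T : a b / a + b}.
Proof. by move=> a b; apply/operatorP => v /=; rewrite scalerDl. Qed.

HB.instance Definition _ := GRing.Zmodule_isLmodule.Build K (operator V)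
  op_scaleA op_scale1 op_scaleDr op_scaleDl.

Fact op_mulA : associative op_mul.
Proof. by move=> S T U; apply/operatorP. Qed.
Fact op_mul1l : left_id op_one op_mul.
Proof. by move=> S; apply/operatorP. Qed.
Fact op_mul1r : right_id op_one op_mul.
Proof. by move=> S; apply/operatorP. Qed.
Fact op_mulDl : left_distributive op_mul +%R.
Proof. by move=> S T U; apply/operatorP. Qed.
Fact op_mulDr : right_distributive op_mul +%R.
Proof. by move=> S T U; apply/operatorP => v /=; exact: raddfD. Qed.

(* Only a [pzRingType]: the identity operator is 0 when V is trivial. *)
HB.instance Definition _ := GRing.Zmodule_isPzRing.Build (operator V)
  op_mulA op_mul1l op_mul1r op_mulDl op_mulDr.

End OperatorRing.

Definition subspace (K : fieldType) (M : lmodType K) (W : set M) : Prop :=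
  W 0 /\ forall (c : K) (u v : M), W u -> W v -> W (c *: u + v).

Section Operators.
Variables (K : fieldType) (V : lmodType K).
Implicit Types (S T : operator V) (F A J P : set (operator V)).

Definition algebraic T : Prop :=
  exists2 p : {poly K}, p != 0 & \sum_(i < size p) p`_i *: T ^+ i = 0.

Definition commutator S T : operator V := S * T - T * S.

Fixpoint lie_power F (k : nat) : set (operator V) :=
  if k is k'.+1 then
    [set commutator S T | S in lie_power F k' & T in F]
  else F.

Definition L_nilpotent F : Prop := exists k : nat, lie_power F k = [set 0].

Definition nilpotent F : Prop :=
  exists2 k : nat, (0 < k)%N &
    forall T : 'I_k -> operator V, (forall i, F (T i)) -> \prod_(i < k) T i = 0.

(* Algebras of operators need not contain the identity operator. *)
Definition subalgebra A : Prop :=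
  subspace A /\ forall S T, A S -> A T -> A (S * T).

Definition generated_algebra F : set (operator V) := smallest subalgebra F.

Definition finite_dimensional A : Prop :=
  exists (d : nat) (e : 'I_d -> operator V),
    A = [set T | exists c : 'I_d -> K, T = \sum_(i < d) c i *: e i].

Definition representation A (M : lmodType K) (rho : operator V -> operator M) :
    Prop :=
  (forall (c : K) S T, A S -> A T -> rho (c *: S + T) = c *: rho S + rho T) /\
  (forall S T, A S -> A T -> rho (S * T) = rho S * rho T).

(* As A may lack an identity, A M <> 0 is part of irreducibility; this also
   forces M <> 0. *)
Definition irreducible A (M : lmodType K) (rho : operator V -> operator M) :
    Prop :=
  (exists2 T, A T & rho T <> 0) /\
  (forall W : set M, subspace W ->
     (forall T (w : M), A T -> W w -> W (rho T w)) ->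
     W = [set 0] \/ W = setT).

Definition primitive_ideal A P : Prop :=
  exists (M : lmodType K) (rho : operator V -> operator M),
    [/\ representation A rho, irreducible A rho
      & P = [set T | A T /\ rho T = 0]].

(* The intersection is taken inside A, hence is A when A has no primitive
   ideal. *)
Definition jacobson_radical A : set (operator V) :=
  A `&` \bigcap_(P in primitive_ideal A) P.

Definition coset J T : set (operator V) := [set T + U | U in J].

Definition quotient A J : set (set (operator V)) := [set coset J T | T in A].

(* The operations of A / J: for X = S + J and Y = T + J they return the cosets
   of S + T, c S and S T, without choosing representatives. *)
Definition quotient_add J (X Y : set (operator V)) : set (operator V) :=
  \bigcup_(S in X) \bigcup_(T in Y) coset J (S + T).
Definition quotient_scale J (c : K) (X : set (operator V)) :
    set (operator V) :=
  \bigcup_(S in X) coset J (c *: S).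
Definition quotient_mul J (X Y : set (operator V)) : set (operator V) :=
  \bigcup_(S in X) \bigcup_(T in Y) coset J (S * T).

Definition quotient_isomorphic_to_power A J (n : nat) : Prop :=
  exists f : set (operator V) -> {ffun 'I_n -> K},
    [/\ set_bij (quotient A J) setT f,
        forall X Y, quotient A J X -> quotient A J Y ->
          f (quotient_add J X Y) = f X + f Y,
        forall (c : K) X, quotient A J X ->
          f (quotient_scale J c X) = c *: (f X : {ffun 'I_n -> K^o})
      & forall X Y, quotient A J X -> quotient A J Y ->
          f (quotient_mul J X Y) = f X * f Y].

End Operators.

(* Main.v *)
From HB Require Import structures.
Require Import Defs.

Set Implicit Arguments.
Unset Strict Implicit.
Unset Printing Implicit Defensive.

Import GRing.Theory.

Local Open Scope ring_scope.
Local Open Scope classical_set_scope.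

(** Let U be the unital algebra generated by F.  The proof never splits V into
    weight spaces; it descends through ideals Q of U, from large ones to 0.

    The basic step (tame_prod) concerns elements z_1, ..., z_m of U that are
    central modulo Q and whose product lies in Q.  Adjoining z_i to Q gives the
    ideal Q + U z_i.  If every Q + U z_i has finite codimension in U, so does
    Q, because x in G_1 + U z_1 and U contained in G_2 + U z_2 give
    x in G_1 + G_2 z_1 + U z_2 z_1, and so on modulo Q.  Likewise, if some
    power of a set N falls into each Q + U z_i, the product of these powers
    falls into Q.  Both properties are bundled in the predicate tame, where N
    is the common kernel, in the generated algebra A, of a finite list of
    characters, that is, of nonzero algebra maps from A to K.

    An ideal modulo which every generator is a scalar is tame (tame_linear):
    U is then K + Q, so Q has codimension at most 1, and the quotient map is a
    character unless Q contains A.  If Q contains the commutators of the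
    generators, each generator t is central modulo Q and a root of a split
    polynomial; adjoining some t - r for each t reduces Q to the previous
    case.  If Q contains only the commutators of length j + 1, those of length
    j are central modulo Q.  They are also nilpotent modulo Q
    (commutator_nilpotent): for z = [S, T] with T algebraic, bracketing with S
    acts on polynomials in T as z d/dT, so p(T) = 0 implies that
    p'(T) z, p''(T) z^2, ... lie in Q, and the last derivative of p is a
    nonzero constant in characteristic 0.  Hence adjoining all of them is again
    a basic step.  As the family is L-nilpotent, the descent reaches Q = 0
    (tame0).

    So U has finite dimension, and there are finitely many characters whose
    common kernel N in A is nilpotent.  Then N is the Jacobson radical
    (jacobson_radicalE): a nilpotent ideal acts as 0 on every irreducible
    representation, and a character is an irreducible representation of
    dimension 1.  Distinct characters can be interpolated
    (character_interpolation), so together they identify A / N with K^n.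
    Finally, for T in A, the product of T and of the T - chi(T) is in N, hence
    nilpotent, so T is algebraic. *)

(* When V is trivial the operators form the zero ring, which has no algebra
   structure of the kind that r%:A denotes. *)
Local Notation "c %:Op" := (c *: (1 : operator _))
  (at level 1, format "c %:Op").

(** * Polynomials in an operator *)

Section OperatorAlgebra.
Variables (K : fieldType) (V : lmodType K).
Implicit Types S T : operator V.

Fact operator_scaleAl (c : K) S T : c *: (S * T) = (c *: S) * T.
Proof. by apply/operatorP. Qed.

Fact operator_scaleAr (c : K) S T : c *: (S * T) = S * (c *: T).
Proof. by apply/operatorP => v /=; apply/esym/(linearZ_LR S). Qed.

Definition op_horner T (p : {poly K}) : operator V :=
  \sum_(i < size p) p`_i *: T ^+ i.

Lemma op_horner_wide n T (p : {poly K}) : (size p <= n)%N ->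
  op_horner T p = \sum_(i < n) p`_i *: T ^+ i.
Proof.
move=> pn; rewrite -(subnKC pn) big_split_ord /=
  [X in _ + X]big1 ?addr0 // => i _.
by rewrite nth_default ?scale0r // leq_addr.
Qed.

Lemma op_hornerD T (p q : {poly K}) :
  op_horner T (p + q) = op_horner T p + op_horner T q.
Proof.
rewrite (op_horner_wide T (size_polyD p q)).
rewrite (op_horner_wide T (leq_maxl (size p) (size q))).
rewrite (op_horner_wide T (leq_maxr (size p) (size q))) -big_split /=.
by apply: eq_bigr => i _; rewrite coefD scalerDl.
Qed.

Lemma op_hornerZ T (c : K) (p : {poly K}) :
  op_horner T (c *: p) = c *: op_horner T p.
Proof.
rewrite (op_horner_wide T (size_scale_leq c p)) scaler_sumr.
by apply: eq_bigr => i _; rewrite coefZ scalerA.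
Qed.

Lemma op_hornerC T (c : K) : op_horner T c%:P = c%:Op.
Proof.
by rewrite (op_horner_wide T (size_polyC_leq1 c)) big_ord1 coefC expr0.
Qed.

Lemma op_horner0 T : op_horner T 0 = 0.
Proof. by rewrite -polyC0 op_hornerC scale0r. Qed.

Lemma op_hornerMX T (p : {poly K}) : op_horner T (p * 'X) = op_horner T p * T.
Proof.
rewrite (op_horner_wide T (size_polyMleq _ _)) size_polyX addn2 /=.
rewrite big_ord_recl coefMX scale0r add0r mulr_suml; apply: eq_bigr => i _.
by rewrite coefMX /= -operator_scaleAl -exprSr.
Qed.

Lemma op_hornerM T (p q : {poly K}) :
  op_horner T (p * q) = op_horner T p * op_horner T q.
Proof.
elim/poly_ind: q => [|q c IH]; first by rewrite mulr0 op_horner0 mulr0.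
rewrite mulrDr mulrA !op_hornerD !op_hornerMX IH mulrDr mulrA; congr (_ + _).
rewrite op_hornerC [p * _]mulrC mul_polyC op_hornerZ -operator_scaleAr.
by rewrite mulr1.
Qed.

Lemma op_hornerX T : op_horner T 'X = T.
Proof. by rewrite -['X]mul1r op_hornerMX op_hornerC scale1r mul1r. Qed.

Lemma op_hornerXn T (p : {poly K}) k :
  op_horner T (p ^+ k) = op_horner T p ^+ k.
Proof.
elim: k => [|k IH]; first by rewrite !expr0 op_hornerC scale1r.
by rewrite !exprS op_hornerM IH.
Qed.

Lemma op_horner_prodXsubC T (rs : seq K) :
  op_horner T (\prod_(r <- rs) ('X - r%:P)) = \prod_(r <- rs) (T - r%:Op).
Proof.
elim: rs => [|r rs IH]; first by rewrite !big_nil op_hornerC scale1r.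
rewrite !big_cons op_hornerM IH op_hornerD op_hornerX -polyCN op_hornerC.
by rewrite scaleNr.
Qed.

End OperatorAlgebra.

(** * Linear spans *)

Section Subspaces.
Variables (K : fieldType) (M : lmodType K).
Implicit Types (W X : set M) (u v : M).

Lemma subspaceD W u v : subspace W -> W u -> W v -> W (u + v).
Proof. by move=> [_ sW] Wu Wv; rewrite -[u]scale1r; exact: sW. Qed.

Lemma subspaceZ W c u : subspace W -> W u -> W (c *: u).
Proof. by move=> [W0 sW] Wu; rewrite -[_ *: _]addr0; exact: sW. Qed.

Lemma subspaceN W u : subspace W -> W u -> W (- u).
Proof. by rewrite -scaleN1r; exact: subspaceZ. Qed.

Lemma subspaceB W u v : subspace W -> W u -> W v -> W (u - v).
Proof. by move=> sW Wu Wv; apply: subspaceD => //; exact: subspaceN. Qed.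

Lemma subspace_sum W (I : Type) (r : seq I) (f : I -> M) :
  subspace W -> (forall i, W (f i)) -> W (\sum_(i <- r) f i).
Proof.
move=> sW Wf; elim/big_ind: _ => [|u v|i _]; [by case: sW| exact: subspaceD|].
exact: Wf.
Qed.

Definition span X : set M := smallest (@subspace K M) X.

Lemma subspace_span X : subspace (span X).
Proof.
split=> [W [[W0 _] _] //|c u v Xu Xv W WX].
by case: (WX) => -[_ sW] _; apply: sW; [exact: Xu|exact: Xv].
Qed.

Lemma sub_span X : X `<=` span X.
Proof. by move=> u Xu W [_]; exact. Qed.

Lemma span_min X W : subspace W -> X `<=` W -> span X `<=` W.
Proof. by move=> sW XW; exact: smallest_sub. Qed.

Lemma span_mono X Y : X `<=` Y -> span X `<=` span Y.
Proof.
move=> XY; apply: span_min; first exact: subspace_span.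
by move=> u /XY; exact: sub_span.
Qed.

Lemma span_seq (s : seq M) :
  span [set` s] = [set u | exists c : 'I_(size s) -> K,
                                u = \sum_(i < size s) c i *: s`_i].
Proof.
apply/seteqP; split=> [|u [c ->]].
  apply: span_min => [|u /= /(nthP 0) [i si <-]].
    split=> [|a u v [c ->] [d ->]].
      by exists (fun=> 0); rewrite big1 // => i _; rewrite scale0r.
    exists (fun i => a * c i + d i); rewrite scaler_sumr -big_split /=.
    by apply: eq_bigr => i _; rewrite scalerDl scalerA.
  exists (fun j => (val j == i)%:R).
  rewrite (bigD1 (Ordinal si)) //= eqxx scale1r big1 ?addr0 // => j.
  by rewrite -val_eqE /= => /negPf ->; rewrite scale0r.
have sS := subspace_span [set` s].
apply: (subspace_sum _ sS) => i; apply: (subspaceZ _ sS).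
by apply: sub_span => /=; rewrite mem_nth.
Qed.

End Subspaces.

(** * Ideals of the generated unital algebra *)

Section Ideals.
Variables (K : fieldType) (V : lmodType K) (F : set (operator V)).
Local Notation Op := (operator V).
Implicit Types (S T a b z : Op) (Q N X Y : set Op).

Definition unital_subalgebra X : Prop := subalgebra X /\ X 1.

Definition unital_algebra : set Op := smallest unital_subalgebra F.
Local Notation U := unital_algebra.
Local Notation A := (generated_algebra F).

Lemma subalgebra_unital : subalgebra U.
Proof.
split; first split=> [X [[[[X0 _] _] _] _] //|c S T US UT X FX].
  by case: (FX) => -[[[_ sX] _] _] _; apply: sX; [exact: US|exact: UT].
move=> S T US UT X FX.
by case: (FX) => -[[_ mX] _] _; apply: mX; [exact: US|exact: UT].
Qed.

Lemma subspace_unital : subspace U. Proof. by case: subalgebra_unital. Qed.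

Lemma unitalM S T : U S -> U T -> U (S * T).
Proof. by move: S T; case: subalgebra_unital. Qed.

Lemma unital1 : U 1. Proof. by move=> X [[]]. Qed.

Lemma gen_unital : F `<=` U. Proof. by move=> S FS X [_]; exact. Qed.

Lemma unital_scalar (c : K) : U c%:Op.
Proof. exact: subspaceZ subspace_unital unital1. Qed.

Lemma unitalX z k : U z -> U (z ^+ k).
Proof.
move=> Uz; elim: k => [|k IH]; first exact: unital1.
by rewrite exprS; exact: unitalM.
Qed.

Lemma unital_prod (s : seq Op) :
  (forall z, z \in s -> U z) -> U (\prod_(z <- s) z).
Proof.
move=> Us; rewrite big_seq; elim/big_ind: _ => //; first exact: unital1.
exact: unitalM.
Qed.

Lemma subalgebra_generated : subalgebra A.
Proof.
split; first split=> [X [[[X0 _] _] _] //|c S T AS AT X FX].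
  by case: (FX) => -[[_ sX] _] _; apply: sX; [exact: AS|exact: AT].
move=> S T AS AT X FX.
by case: (FX) => -[_ mX] _; apply: mX; [exact: AS|exact: AT].
Qed.

Lemma subspace_generated : subspace A.
Proof. by case: subalgebra_generated. Qed.

Lemma generatedM S T : A S -> A T -> A (S * T).
Proof. by move: S T; case: subalgebra_generated. Qed.

Lemma gen_generated : F `<=` A. Proof. by move=> S FS X [_]; exact. Qed.

Lemma generated_sub_unital : A `<=` U.
Proof.
by apply: smallest_sub; [exact: subalgebra_unital|exact: gen_unital].
Qed.

Lemma generated_mul_unital S T : A S -> U T -> A (S * T).
Proof.
move=> + UT; move: T UT S.
suff: U `<=` [set T | forall S, A S -> A (S * T)] by [].
apply: smallest_sub => [|T /gen_generated AT S AS]; last exact: generatedM.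
have sA := subspace_generated.
split=> [|S AS]; last by rewrite mulr1.
split; first split=> [S AS|c T T' AT AT' S AS].
- by rewrite mulr0; case: sA.
- rewrite mulrDr -operator_scaleAr; apply: (subspaceD sA); last exact: AT'.
  by apply: (subspaceZ _ sA); exact: AT.
by move=> T T' AT AT' S AS; rewrite mulrA; exact: (AT' _ (AT _ AS)).
Qed.

Definition setM X Y : set Op := [set S * T | S in X & T in Y].

Fixpoint setpow X (k : nat) : set Op :=
  if k is k'.+1 then setM X (setpow X k') else [set 1].

(** This transfers finite dimension from U to A: multiplying a finite spanning
    set of U by the finite set F gives a finite spanning set of A. *)
Lemma generatedE : A = span (setM F U).
Proof.
apply/seteqP; split.
  apply: smallest_sub => [|T FT]; last first.
    apply: sub_span; exists T => //.
    by exists 1; [exact: unital1|rewrite mulr1].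
  have sS := subspace_span (setM F U).
  have UF : span (setM F U) `<=` U.
    apply: span_min => [|_ [S FS [T UT <-]]]; first exact: subspace_unital.
    by apply: unitalM => //; exact: gen_unital.
  split=> // S T FS /UF UT; move: S FS.
  suff: span (setM F U) `<=` [set S | span (setM F U) (S * T)] by [].
  apply: span_min => [|_ [S FS [S' US' <-]]].
    split=> [|c S S' FS FS'] /=; first by rewrite mul0r; case: sS.
    by rewrite /= mulrDl -operator_scaleAl; exact: sS.2.
  apply: sub_span; exists S => //; exists (S' * T); first exact: unitalM.
  by rewrite mulrA.
apply: span_min => [|_ [S FS [T UT <-]]]; first exact: subspace_generated.
by apply: generated_mul_unital => //; exact: gen_generated.
Qed.

Definition ideal Q : Prop :=
  subspace Q /\ forall a S, U a -> Q S -> Q (a * S) /\ Q (S * a).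

Lemma idealMl Q a S : ideal Q -> U a -> Q S -> Q (a * S).
Proof. by move=> [_ mQ] Ua QS; case: (mQ a S). Qed.

Lemma idealMr Q a S : ideal Q -> U a -> Q S -> Q (S * a).
Proof. by move=> [_ mQ] Ua QS; case: (mQ a S). Qed.

Definition eqmod Q S T : Prop := Q (S - T).

Lemma eqmod_refl Q S : ideal Q -> eqmod Q S S.
Proof. by move=> [[Q0 _] _]; rewrite /eqmod subrr. Qed.

Lemma eqmod_sym Q S T : ideal Q -> eqmod Q S T -> eqmod Q T S.
Proof. by move=> [sQ _] /(subspaceN sQ); rewrite opprB. Qed.

Lemma eqmod_trans Q T S S' : ideal Q -> eqmod Q S T -> eqmod Q T S' ->
  eqmod Q S S'.
Proof.
by move=> [sQ _] ST TS'; have := subspaceD sQ ST TS'; rewrite addrA subrK.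
Qed.

Lemma eqmodD Q S T S' T' : ideal Q -> eqmod Q S S' -> eqmod Q T T' ->
  eqmod Q (S + T) (S' + T').
Proof.
move=> [sQ _] SS' TT'; rewrite /eqmod opprD addrACA.
exact: subspaceD.
Qed.

Lemma eqmodMl Q a S T : ideal Q -> U a -> eqmod Q S T ->
  eqmod Q (a * S) (a * T).
Proof. by move=> iQ Ua ST; rewrite /eqmod -mulrBr; exact: idealMl. Qed.

Lemma eqmodMr Q a S T : ideal Q -> U a -> eqmod Q S T ->
  eqmod Q (S * a) (T * a).
Proof. by move=> iQ Ua ST; rewrite /eqmod -mulrBl; exact: idealMr. Qed.

Lemma eqmodM Q S T S' T' : ideal Q -> U S -> U T' ->
  eqmod Q S S' -> eqmod Q T T' -> eqmod Q (S * T) (S' * T').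
Proof.
move=> iQ US UT' SS' TT'; apply: (eqmod_trans (T := S * T')) => //.
  exact: eqmodMl.
exact: eqmodMr.
Qed.

Lemma eqmod_in Q S T : ideal Q -> eqmod Q S T -> Q T -> Q S.
Proof. by move=> [sQ _] ST QT; rewrite -(subrK T S); exact: subspaceD. Qed.

Definition central Q z : Prop := forall a, U a -> eqmod Q (z * a) (a * z).

Lemma central_sub Q Q' z : Q `<=` Q' -> central Q z -> central Q' z.
Proof. by move=> QQ' cz a /cz /QQ'. Qed.

Lemma central_gen Q z : ideal Q ->
  (forall t, F t -> eqmod Q (z * t) (t * z)) -> central Q z.
Proof.
move=> iQ cz; have sQ := iQ.1.
suff: U `<=` U `&` [set a | eqmod Q (z * a) (a * z)] by move=> UC a /UC [].
apply: smallest_sub; last by move=> t Ft; split; [exact: gen_unital|exact: cz].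
have sU := subspace_unital.
split; last first.
  by split; [exact: unital1|rewrite /= mulr1 mul1r; exact: eqmod_refl].
split; first split.
- by split; [case: sU|rewrite /= mulr0 mul0r; exact: eqmod_refl].
- move=> c a b [Ua za] [Ub zb]; split; first exact: sU.2.
  rewrite /= mulrDr mulrDl -operator_scaleAl -operator_scaleAr.
  apply: eqmodD => //.
  by rewrite /eqmod -scalerBr; exact: subspaceZ.
- move=> a b [Ua za] [Ub zb]; split; first exact: unitalM.
  apply: (eqmod_trans (T := a * z * b)) => //=.
    by rewrite mulrA; exact: eqmodMr.
  by rewrite -!mulrA; exact: eqmodMl.
Qed.

Lemma central_subA Q z (c : K) :
  ideal Q -> central Q z -> central Q (z - c%:Op).
Proof.
move=> iQ cz a Ua; rewrite mulrBl mulrBr.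
rewrite -operator_scaleAl -operator_scaleAr mul1r mulr1.
by rewrite /eqmod opprB subrKA; exact: cz.
Qed.

(** The ideal Q + U z, provided that z is central modulo Q. *)
Definition adjoin Q z : set Op := [set S | exists2 a, U a & eqmod Q S (a * z)].

Lemma adjoin_ideal Q z : ideal Q -> central Q z -> ideal (adjoin Q z).
Proof.
move=> iQ cz; have sU := subspace_unital; have sQ := iQ.1; split; first split.
- by exists 0; [case: sU|rewrite mul0r; exact: eqmod_refl].
- move=> c S T [a Ua Sa] [b Ub Tb]; exists (c *: a + b); first exact: sU.2.
  rewrite mulrDl -operator_scaleAl; apply: eqmodD => //.
  by rewrite /eqmod -scalerBr; exact: subspaceZ.
move=> a S Ua [b Ub Sb]; split.
  by exists (a * b); [exact: unitalM|rewrite -mulrA; exact: eqmodMl].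
exists (b * a); first exact: unitalM.
apply: (eqmod_trans (T := b * z * a)) => //; first exact: eqmodMr.
by rewrite -!mulrA; apply: eqmodMl => //; exact: cz.
Qed.

Lemma sub_adjoin Q z : Q `<=` adjoin Q z.
Proof.
move=> S QS; exists 0; first by case: subspace_unital.
by rewrite mul0r /eqmod subr0.
Qed.

Lemma mem_adjoin Q z : ideal Q -> adjoin Q z z.
Proof.
by move=> iQ; exists 1; rewrite ?mul1r; [exact: unital1|exact: eqmod_refl].
Qed.

(** Finite codimension in U. *)
Definition cofinite Q : Prop :=
  exists G, [/\ finite_set G, G `<=` U
    & forall a, U a -> exists2 g, span G g & eqmod Q a g].

Lemma span_mulr X a S : span X S -> span [set x * a | x in X] (S * a).
Proof.
have sX := subspace_span [set x * a | x in X].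
move: S; apply: span_min => [|x Xx /=]; last by apply: sub_span; exists x.
split=> [|c u v Xu Xv]; first by rewrite /= mul0r; case: sX.
by rewrite /= mulrDl -operator_scaleAl; exact: sX.2.
Qed.

(** Divide by the z's one after the other: the quotient of one division is the
    dividend of the next, and the remainders stay in a finite-dimensional
    space. *)
Lemma cofinite_adjoin_prod Q (zs : seq Op) : ideal Q ->
  (forall z, z \in zs -> cofinite (adjoin Q z)) ->
  (forall z, z \in zs -> U z) ->
  exists G, [/\ finite_set G, G `<=` U & forall a, U a ->
    exists2 g, span G g
      & exists2 b, U b & eqmod Q (a - g) (b * \prod_(z <- zs) z)].
Proof.
move=> iQ; elim: zs => [_ _|z zs IH cof Uzs].
  exists set0; split=> // a Ua; exists 0.
    by case: (@subspace_span K Op set0).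
  by exists a => //; rewrite big_nil mulr1 subr0; exact: eqmod_refl.
have [w wzs|w wzs|G [finG GU UG]] := IH.
- by apply: cof; rewrite inE wzs orbT.
- by apply: Uzs; rewrite inE wzs orbT.
have [H [finH HU UH]] := cof z (mem_head _ _).
set P := \prod_(w <- zs) w in UG *.
have UP : U P by apply: unital_prod => w wzs; apply: Uzs; rewrite inE wzs orbT.
exists (G `|` [set h * P | h in H]); split.
- by rewrite finite_setU; split=> //; exact: finite_image.
- by move=> _ [/GU//|[h /HU Uh <-]]; exact: unitalM.
move=> a /UG [g Gg [b /UH [h Hh [b' Ub' bh]] agb]].
exists (g + h * P).
  apply: (subspaceD (@subspace_span _ _ _)).
    by apply: (span_mono _ Gg) => x; left.
  by apply: (span_mono _ (span_mulr (a := P) Hh)) => x; right.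
exists b' => //; rewrite big_cons -/P opprD addrA mulrA.
apply: (eqmod_trans (T := b * P - h * P)) => //.
  by apply: eqmodD => //; exact: eqmod_refl.
by rewrite -mulrBl; exact: eqmodMr.
Qed.

Lemma setpow_unital X k : X `<=` U -> setpow X k `<=` U.
Proof.
move=> XU; elim: k => [_ ->|k IH _ [S /XU US [T /IH UT <-]]].
  exact: unital1.
exact: unitalM.
Qed.

Lemma setpowD X j k S : setpow X (j + k) S ->
  exists2 a, setpow X j a & exists2 b, setpow X k b & S = a * b.
Proof.
elim: j S => [|j IH] S; first by exists 1 => //; exists S => //; rewrite mul1r.
move=> [x Xx [_ /IH[a ja [b kb ->]] <-]].
by exists (x * a); [exists x => //; exists a|exists b; rewrite // mulrA].
Qed.

Lemma setpow_sub X Y k : X `<=` Y -> setpow X k `<=` setpow Y k.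
Proof.
move=> XY; elim: k => // k IH _ [S /XY YS [T /IH YT <-]].
by exists S => //; exists T.
Qed.

(** * Commutators central modulo an ideal *)

Lemma central_exp Q z k : ideal Q -> U z -> central Q z -> central Q (z ^+ k).
Proof.
move=> iQ Uz cz a Ua; elim: k => [|k IH].
  by rewrite expr0 mulr1 mul1r; exact: eqmod_refl.
rewrite exprS -mulrA; apply: (eqmod_trans (T := z * (a * z ^+ k))) => //.
  exact: eqmodMl.
by rewrite !mulrA; apply: eqmodMr => //; [exact: unitalX|exact: cz].
Qed.

Lemma unital_op_horner T (p : {poly K}) : U T -> U (op_horner T p).
Proof.
move=> UT; have sU := subspace_unital.
by apply: (subspace_sum _ sU) => i; apply: (subspaceZ _ sU); exact: unitalX.
Qed.

(** Modulo Q, where [S, T] is central, bracketing with S is the derivation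
    [S, T] d/dT on polynomials in T. *)
Lemma commutator_op_horner Q S T (p : {poly K}) : ideal Q -> U S -> U T ->
  central Q (commutator S T) ->
  eqmod Q (S * op_horner T p)
          (op_horner T p * S + op_horner T p^`() * commutator S T).
Proof.
move=> iQ US UT; set z := commutator S T => cz.
elim/poly_ind: p => [|p c IH].
  by rewrite deriv0 op_horner0 !mul0r mulr0 addr0; exact: eqmod_refl.
have Up := unital_op_horner _ UT.
rewrite derivD derivC addr0 derivM derivX mulr1 !op_hornerD !op_hornerMX.
rewrite op_hornerC mulrDr !mulrDl addrAC -operator_scaleAl -operator_scaleAr.
rewrite mulr1 mul1r; apply: eqmodD => //; last exact: eqmod_refl.
rewrite mulrA; apply: (eqmod_trans iQ (eqmodMr iQ UT IH)) => //.
rewrite mulrDl [X in eqmod _ _ X]addrCA [X in eqmod _ X _]addrC.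
apply: eqmodD => //.
  by rewrite -!mulrA; apply: eqmodMl => //; exact: cz.
rewrite -!mulrA -mulrDr /z /commutator [T * S + _]addrC subrK.
exact: eqmod_refl.
Qed.

Lemma derivn_top (p : {poly K}) :
  p^`((size p).-1) = (lead_coef p *+ (size p).-1`!)%:P.
Proof.
apply/polyP => i; rewrite coef_derivn coefC; case: i => [|i] /=.
  by rewrite addn0 ffactnn.
rewrite nth_default ?mul0rn //; case: (size p) => [|n] //=.
by rewrite addnS ltnS leq_addr.
Qed.

(** Bracketing p(T) z^n with S gives p'(T) z^(n+1) modulo Q.  Starting from an
    annihilating polynomial of T, the iterated derivatives stay in Q until a
    nonzero constant is reached. *)
Lemma commutator_nilpotent Q S T : [pchar K] =i pred0 ->
  ideal Q -> U S -> U T -> central Q (commutator S T) -> algebraic T ->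
  exists m, Q (commutator S T ^+ m).
Proof.
move=> char0 iQ US UT cz [p p0 pT].
set z := commutator S T in cz *.
have Uz : U z by apply: subspaceB subspace_unital _ _; exact: unitalM.
have Up q := unital_op_horner q UT.
(* z is central, so S does commute with z ^+ n modulo Q. *)
have Qder n : Q (op_horner T p^`(n) * z ^+ n).
  elim: n => [|n IH].
    by rewrite expr0 mulr1 derivn0 /op_horner pT; case: iQ => [[]].
  set q := p^`(n) in IH *; rewrite derivnS -/q exprS mulrA.
  have : Q (S * op_horner T q * z ^+ n) by rewrite -mulrA; exact: idealMl.
  have Qr : Q (op_horner T q * S * z ^+ n).
    apply: (eqmod_in (T := op_horner T q * z ^+ n * S)) => //.
      rewrite -!mulrA; apply: eqmodMl => //; apply: eqmod_sym => //.
      exact: central_exp.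
    exact: idealMr.
  move/(eqmod_in iQ (eqmod_sym iQ
    (eqmodMr iQ (unitalX n Uz) (commutator_op_horner q iQ US UT cz)))).
  rewrite mulrDl => Qs; have := subspaceB iQ.1 Qs Qr.
  by rewrite addrAC subrr add0r.
exists (size p).-1; have := Qder (size p).-1.
rewrite derivn_top op_hornerC -operator_scaleAl mul1r => Qz.
set c := lead_coef p *+ _ in Qz.
have c0 : c != 0.
  rewrite /c -mulr_natr mulf_neq0 ?lead_coef_eq0 //.
  by rewrite ((pcharf0P K).1 char0) -lt0n fact_gt0.
by rewrite -[z ^+ _]scale1r -(mulVf c0) -scalerA; exact: subspaceZ iQ.1 Qz.
Qed.

(** * Tame ideals *)

(** Characters vanish outside A, so that two of them are equal as soon as they
    agree on A. *)
Definition character (chi : Op -> K) : Prop :=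
  [/\ forall c S T, A S -> A T -> chi (c *: S + T) = c * chi S + chi T,
      forall S T, A S -> A T -> chi (S * T) = chi S * chi T,
      forall S, ~ A S -> chi S = 0
    & exists2 S, A S & chi S != 0].

Implicit Types (chi : Op -> K) (s : seq (Op -> K)).

Definition common_kernel s : set Op :=
  [set S | A S /\ forall chi, chi \in s -> chi S = 0].

(** The two properties that descend from the ideals Q + U z_i to Q.  For Q = 0
    the second one yields the radical. *)
Definition tame Q : Prop :=
  cofinite Q /\ exists2 s, (forall chi, chi \in s -> character chi)
    & exists k, setpow (common_kernel s) k `<=` Q.

Lemma common_kernel_unital s : common_kernel s `<=` U.
Proof. by move=> S [AS _]; exact: generated_sub_unital. Qed.

(** If X^j lies in Q + U z and X^k in Q + U P, then X^(j+k) lies in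
    Q + U z U P, which is Q + U z P because z is central modulo Q.  Enlarging
    the list of characters only shrinks the common kernel. *)
Lemma nilpotent_adjoin_prod Q (zs : seq Op) : ideal Q ->
  (forall z, z \in zs -> [/\ U z, central Q z & tame (adjoin Q z)]) ->
  exists2 s, (forall chi, chi \in s -> character chi)
    & exists k, forall S, setpow (common_kernel s) k S ->
        exists2 b, U b & eqmod Q S (b * \prod_(z <- zs) z).
Proof.
move=> iQ; elim: zs => [_|z zs IH tam].
  exists [::] => //; exists 0 => S ->; exists 1; first exact: unital1.
  by rewrite big_nil mulr1; exact: eqmod_refl.
have [w wzs|s1 ch1 [k1 nil1]] := IH; first by apply: tam; rewrite inE wzs orbT.
have [Uz cz [_ [s2 ch2 [k2 nil2]]]] := tam z (mem_head _ _).
exists (s2 ++ s1).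
  by move=> chi; rewrite mem_cat => /orP[/ch2|/ch1].
exists (k2 + k1)%N => S /setpowD [x Nx [y Ny ->]].
have Ux := setpow_unital (@common_kernel_unital _) Nx.
have {Ny}/nil1 [b Ub yb] : setpow (common_kernel s1) k1 y.
  apply: setpow_sub Ny => T [AT sT]; split=> // chi s1chi.
  by apply: sT; rewrite mem_cat s1chi orbT.
have {Nx}/nil2 [a Ua xa] : setpow (common_kernel s2) k2 x.
  apply: setpow_sub Nx => T [AT sT]; split=> // chi s2chi.
  by apply: sT; rewrite mem_cat s2chi.
set P := \prod_(w <- zs) w in yb *.
have UP : U P.
  by apply: unital_prod => w wzs; case: (tam w) => //; rewrite inE wzs orbT.
exists (a * b); first exact: unitalM.
apply: (eqmod_trans (T := a * z * (b * P))) => //.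
  by apply: eqmodM => //; exact: unitalM.
rewrite big_cons -/P -[a * z * _]mulrA -[a * b * _]mulrA; apply: eqmodMl => //.
by rewrite !mulrA; apply: eqmodMr => //; exact: cz.
Qed.

Lemma tame_prod Q (zs : seq Op) : ideal Q ->
  (forall z, z \in zs -> [/\ U z, central Q z & tame (adjoin Q z)]) ->
  Q (\prod_(z <- zs) z) -> tame Q.
Proof.
move=> iQ tam Qzs.
have Qb b S : U b -> eqmod Q S (b * \prod_(z <- zs) z) -> Q S.
  by move=> Ub /(eqmod_in iQ); apply; exact: idealMl.
split.
  have [z /tam[_ _ []] //|z /tam[] //|G [finG GU UG]] :=
    @cofinite_adjoin_prod Q zs iQ.
  exists G; split=> // a /UG [g Gg [b Ub agb]]; exists g => //.
  exact: Qb agb.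
have [s ch [k nil]] := nilpotent_adjoin_prod iQ tam.
by exists s => //; exists k => S /nil [b Ub /Qb]; exact.
Qed.

(** Each z in zs is a root modulo Q of a polynomial with roots in L, and
    tame_prod applied to its linear factors makes z equal to one of these roots.
    This is used with L = K for the generators, and with L = {0} for
    commutators, where it says that nilpotent elements may be adjoined. *)
Lemma tame_adjoin_seq (L : set K) (zs : seq Op) Q : ideal Q ->
  (forall z, z \in zs -> [/\ U z, central Q z
     & exists2 rs : seq K, (forall r, r \in rs -> L r)
         & Q (\prod_(r <- rs) (z - r%:Op))]) ->
  (forall Q', ideal Q' -> Q `<=` Q' ->
     (forall z, z \in zs -> exists2 r, L r & Q' (z - r%:Op)) -> tame Q') ->
  tame Q.
Proof.
elim: zs Q => [|z zs IH] Q iQ alg tam; first exact: tam.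
have [Uz cz [rs Lrs Qrs]] := alg z (mem_head _ _).
apply: (tame_prod (zs := [seq z - r%:Op | r <- rs])) => //; last first.
  by rewrite big_map.
move=> _ /mapP [r rsr ->]; have czr := central_subA r iQ cz.
split=> //.
  by apply: subspaceB subspace_unital _ _ => //; exact: unital_scalar.
apply: IH => [|w wzs|Q' iQ' QQ' lin]; first exact: adjoin_ideal.
  have [|Uw cw [rw Lrw Qrw]] := alg w; first by rewrite inE wzs orbT.
  split=> //; first exact: central_sub (@sub_adjoin _ _) cw.
  by exists rw => //; exact: sub_adjoin.
apply: tam => // [S /sub_adjoin|w].
  by move/(_ (z - r%:Op))/QQ'.
rewrite inE => /predU1P[->|/lin //]; exists r; first exact: Lrs.
by apply: QQ'; exact: mem_adjoin.
Qed.

Lemma linear_mod_scalar Q : ideal Q ->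
  (forall t, F t -> exists r, Q (t - r%:Op)) ->
  forall a, U a -> exists c, eqmod Q a c%:Op.
Proof.
move=> iQ lin; have sU := subspace_unital.
suff: U `<=` U `&` [set a | exists c, eqmod Q a c%:Op] by move=> UC a /UC [].
apply: smallest_sub => [|t Ft]; last by split; [exact: gen_unital|exact: lin].
split; last first.
  by split; [exact: unital1|exists 1; rewrite scale1r; exact: eqmod_refl].
split; first split.
- by split; [case: sU|exists 0; rewrite scale0r; exact: eqmod_refl].
- move=> c a b [Ua [ca aca]] [Ub [cb bcb]]; split; first exact: sU.2.
  exists (c * ca + cb); rewrite scalerDl -scalerA; apply: eqmodD => //.
  by rewrite /eqmod -scalerBr; exact: subspaceZ iQ.1 _.
- move=> a b [Ua [ca aca]] [Ub [cb bcb]]; split; first exact: unitalM.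
  exists (ca * cb); rewrite -scalerA -[cb%:Op]mul1r operator_scaleAl.
  by apply: eqmodM => //; exact: unital_scalar.
Qed.

Lemma tame_linear Q : ideal Q -> (forall t, F t -> exists r, Q (t - r%:Op)) ->
  tame Q.
Proof.
move=> iQ lin; have sQ := iQ.1; have sA := subspace_generated.
have scal := linear_mod_scalar iQ lin; split.
  exists [set 1]; split=> [|_ ->|a /scal [c ac]]; first exact: finite_set1.
    exact: unital1.
  exists c%:Op => //; apply: (subspaceZ _ (@subspace_span _ _ _)).
  exact: sub_span.
(* Q may be improper: then it contains A, and the empty list of characters
   will do. *)
have [Q1|nQ1] := pselect (Q 1).
  exists [::] => //; exists 1 => _ [S /common_kernel_unital US [_ -> <-]].
  by rewrite mulr1 -[S]mulr1; exact: idealMl.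
have uniq S c d : eqmod Q S c%:Op -> eqmod Q S d%:Op -> c = d.
  move=> Sc Sd; apply/eqP; rewrite -subr_eq0; apply/negP => /negP cd.
  have /(subspaceZ (c - d)^-1 sQ) := eqmod_trans iQ (eqmod_sym iQ Sc) Sd.
  by rewrite -scalerBl scalerA mulVf // scale1r.
pose chi S : K := if asbool (A S) then xget 0 [set c | eqmod Q S c%:Op] else 0.
have chiE S c : A S -> eqmod Q S c%:Op -> chi S = c.
  move=> AS Sc; rewrite /chi asboolT //; apply: (uniq S) => //.
  by apply: (xgetPex 0 (P := [set c | eqmod Q S c%:Op])); exists c.
have chiP S : A S -> eqmod Q S (chi S)%:Op.
  move=> AS; have [c Sc] := scal S (generated_sub_unital AS).
  by rewrite (chiE S c).
(* The map U -> U / Q = K may vanish on A, which may lack a unit. *)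
have [chi0|/existsNP[T /not_implyP[AT /eqP chiT]]] :=
    pselect (forall S, A S -> chi S = 0).
  exists [::] => //; exists 1 => _ [S [AS _] [_ -> <-]]; rewrite mulr1.
  by have := chiP S AS; rewrite chi0 // scale0r /eqmod subr0.
exists [:: chi] => [_ /[1!inE] /eqP ->|]; last first.
  exists 1 => _ [S [AS chiS] [_ -> <-]]; rewrite mulr1.
  by have := chiP S AS; rewrite chiS ?mem_head // scale0r /eqmod subr0.
split=> [c S S' AS AS'|S S' AS AS'|S nAS|]; last by exists T.
- apply: chiE; first exact: sA.2.
  rewrite scalerDl -scalerA; apply: eqmodD => //; last exact: chiP.
  by rewrite /eqmod -scalerBr; apply: (subspaceZ _ sQ); exact: chiP.
- apply: chiE; first exact: generatedM.
  rewrite -scalerA -[X in chi S *: X]mul1r operator_scaleAl.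
  apply: eqmodM => //; [exact: generated_sub_unital|exact: unital_scalar| |];
  exact: chiP.
- by rewrite /chi asboolF.
Qed.

(** * Iterated commutators of the generators *)

Lemma lie_power_unital j : lie_power F j `<=` U.
Proof.
elim: j => [|j IH]; first exact: gen_unital.
move=> _ [S /IH US [T /gen_unital UT <-]].
by apply: subspaceB subspace_unital _ _; exact: unitalM.
Qed.

Lemma finite_lie_power j : finite_set F -> finite_set (lie_power F j).
Proof. by move=> finF; elim: j => //= j IH; exact: finite_image2. Qed.

Lemma lie_power_central Q j z : ideal Q -> lie_power F j.+1 `<=` Q ->
  lie_power F j z -> central Q z.
Proof.
move=> iQ FQ Fz; apply: central_gen => // t Ft.
by apply: FQ; exists z => //; exists t.
Qed.

End Ideals.

(** * Characters and the Jacobson radical *)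

Section Radical.
Variables (K : fieldType) (V : lmodType K) (F : set (operator V)).
Local Notation Op := (operator V).
Local Notation A := (generated_algebra F).
Implicit Types (S T : Op) (chi : Op -> K) (s : seq (Op -> K)).

Lemma character0 chi : character F chi -> chi 0 = 0.
Proof.
move=> [lin _ _ _]; have [[A0 _] _] := subalgebra_generated F.
have /eqP := lin 1 0 0 A0 A0.
by rewrite scaler0 addr0 mul1r -subr_eq subrr eq_sym => /eqP.
Qed.

Lemma characterZ chi c S : character F chi -> A S -> chi (c *: S) = c * chi S.
Proof.
move=> ch AS; have [lin _ _ _] := ch; have [[A0 _] _] := subalgebra_generated F.
by have := lin c S 0 AS A0; rewrite !addr0 character0 // addr0.
Qed.

Lemma characterD chi S T : character F chi -> A S -> A T ->
  chi (S + T) = chi S + chi T.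
Proof.
by move=> [lin _ _ _] AS AT; rewrite -[S]scale1r lin // mul1r scale1r.
Qed.

Lemma characterM chi S T : character F chi -> A S -> A T ->
  chi (S * T) = chi S * chi T.
Proof. by move=> [_ mul _ _]; exact: mul. Qed.

Lemma character_sum chi (I : Type) (r : seq I) (f : I -> Op) :
  character F chi -> (forall i, A (f i)) ->
  chi (\sum_(i <- r) f i) = \sum_(i <- r) chi (f i).
Proof.
move=> ch Af; elim: r => [|i r IH]; first by rewrite !big_nil character0.
rewrite !big_cons characterD ?IH //.
exact: subspace_sum (subspace_generated F) _.
Qed.

Lemma characterB chi S T : character F chi -> A S -> A T ->
  chi (S - T) = chi S - chi T.
Proof.
move=> ch AS AT; rewrite -scaleN1r characterD ?characterZ ?mulN1r //.
exact: subspaceZ (subspace_generated F) _.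
Qed.

Lemma common_kernel_ideal s S T : (forall chi, chi \in s -> character F chi) ->
  A S -> common_kernel F s T ->
  common_kernel F s (S * T) /\ common_kernel F s (T * S).
Proof.
move=> ch AS [AT kT]; split; (split; first exact: generatedM) => chi chis.
  by rewrite characterM ?kT ?mulr0 //; exact: ch.
by rewrite characterM ?kT ?mul0r //; exact: ch.
Qed.

Section Representation.
Variables (M : lmodType K) (rho : Op -> operator M).
Hypothesis rep : representation A rho.

Lemma representation0 : rho 0 = 0.
Proof.
have [[A0 _] _] := subalgebra_generated F.
have /eqP := rep.1 1 0 0 A0 A0.
by rewrite scaler0 addr0 scale1r -subr_eq subrr eq_sym => /eqP.
Qed.

(** The vectors killed by N form a submodule W.  If W were 0, every nonzero
    vector could be moved to a nonzero vector by some element of N, again and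
    again, against the nilpotency of N. *)
Lemma irreducible_nilpotent_ideal (N : set Op) k :
  irreducible A rho -> N `<=` A ->
  (forall S T, A S -> N T -> N (T * S)) -> setpow N k `<=` [set 0] ->
  forall T, N T -> rho T = 0.
Proof.
move=> [_ irr] NA Nr nil.
pose W : set M := [set w | forall T, N T -> rho T w = 0].
have sW : subspace W.
  split=> [T NT|c u v Wu Wv T NT]; first by rewrite raddf0.
  by rewrite linearP Wu // Wv // scaler0 addr0.
have [|W0|WT] := irr W sW.
- move=> S w AS Ww T NT; have := rep.2 T S (NA _ NT) AS.
  by move/(congr1 (fun f : operator M => f w)) => /= <-; apply: Ww; exact: Nr.
- have step w : w <> 0 -> exists2 T, N T & rho T w <> 0.
    move=> w0; apply: contrapT => noT; apply: w0; suff : W w by rewrite W0.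
    by move=> T NT; apply: contrapT => Tw; apply: noT; exists T.
  have steps j w : w <> 0 -> exists2 T, setpow N j.+1 T & A T /\ rho T w <> 0.
    move=> w0; elim: j => [|j [T NT [AT Tw]]].
      have [T NT Tw] := step w w0; exists T; last by split => //; exact: NA.
      by exists T => //; exists 1; rewrite ?mulr1.
    have [S NS Sw] := step _ Tw.
    exists (S * T); first by exists S => //; exists T.
    split; first by apply: generatedM => //; exact: NA.
    by rewrite rep.2 //; exact: NA.
  move=> T NT; apply/operatorP => v; apply: contrapT => Tv.
  have [S [S' _ [S'' /nil -> <-]] [_]] := steps k _ Tv.
  by rewrite mulr0 representation0.
move=> T NT; apply/operatorP => v; have Wv : W v by rewrite WT.
exact: Wv.
Qed.

End Representation.

Lemma character_primitive chi : character F chi ->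
  primitive_ideal A [set S | A S /\ chi S = 0].
Proof.
move=> ch; have [lin mul _ [S AS chiS]] := ch.
exists K^o, (fun S => (chi S)%:Op); split; first split.
- by move=> c T T' AT AT'; rewrite lin // scalerDl scalerA.
- move=> T T' AT AT'; rewrite mul // -scalerA.
  by rewrite -[X in chi T *: X]mul1r operator_scaleAl.
- split.
    exists S => //; move/(congr1 (fun f : operator K^o => f 1)) => /= /eqP.
    by rewrite scaler_eq0 oner_eq0 orbF (negPf chiS).
  move=> W sW _; have [W0|/existsNP[w /not_implyP[Ww /eqP w0]]] :=
      pselect (forall w, W w -> w = 0).
    by left; apply/seteqP; split=> [w /W0 //|_ ->]; case: sW.
  right; apply/seteqP; split=> // v _.
  by rewrite -[v](mulfVK w0); exact: (subspaceZ _ sW).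
- apply/seteqP; split=> T /= [AT chiT]; split=> //.
    by rewrite chiT scale0r.
  move: chiT => /(congr1 (fun f : operator K^o => f 1)) /= /eqP.
  by rewrite scaler_eq0 oner_eq0 orbF => /eqP.
Qed.

(** Any finite list of characters with nilpotent common kernel determines the
    radical. *)
Lemma jacobson_radicalE s k : (forall chi, chi \in s -> character F chi) ->
  setpow (common_kernel F s) k `<=` [set 0] ->
  jacobson_radical A = common_kernel F s.
Proof.
move=> ch nil; apply/seteqP; split=> [T [AT JT]|T [AT kT]].
  split=> // chi /ch /character_primitive chiP.
  by have [] := JT _ chiP.
split=> // P [M [rho [rep irr ->]]]; split=> //.
apply: (irreducible_nilpotent_ideal rep irr _ _ nil) => // [S []//|].
by move=> S S' AS kS'; case: (common_kernel_ideal ch AS kS').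
Qed.

Lemma setpow_nilpotent (N : set Op) k : setpow N k `<=` [set 0] -> nilpotent N.
Proof.
move=> nil; exists k.+1 => // T NT.
have powN j (t : 'I_j -> Op) :
    (forall i, N (t i)) -> setpow N j (\prod_(i < j) t i).
  elim: j t => [|j IH] t Nt; first by rewrite big_ord0.
  rewrite big_ord_recl; exists (t ord0) => //.
  by exists (\prod_(i < j) t (lift ord0 i)) => //; exact: IH.
rewrite big_ord_recl (nil (\prod_(i < k) T (lift ord0 i))) ?mulr0 //.
by apply: powN => i.
Qed.

Lemma setpow_exp (N : set Op) k T : N T -> setpow N k (T ^+ k).
Proof.
move=> NT; elim: k => [|k IH]; first by rewrite expr0.
by exists T => //; exists (T ^+ k); rewrite // exprS.
Qed.

(** * Algebraic elements and the quotient by the radical *)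

(** The factor 'X makes up for the missing unit of A. *)
Lemma generated_horner T (p : {poly K}) : A T -> A (op_horner T ('X * p)).
Proof.
move=> AT; rewrite op_hornerM op_hornerX; apply: generated_mul_unital => //.
by apply: unital_op_horner; exact: generated_sub_unital.
Qed.

Lemma character_horner chi T (p : {poly K}) : character F chi -> A T ->
  chi (op_horner T ('X * p)) = chi T * p.[chi T].
Proof.
move=> ch AT; have sA := subspace_generated F.
have AT' i : A (T * T ^+ i).
  apply: generated_mul_unital => //.
  by apply: unitalX; exact: generated_sub_unital.
have chiT i : chi (T * T ^+ i) = chi T ^+ i.+1.
  elim: i => [|i IH]; first by rewrite expr0 mulr1 expr1.
  by rewrite exprS characterM // IH -exprS.
rewrite op_hornerM op_hornerX /op_horner mulr_sumr horner_coef mulr_sumr.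
rewrite character_sum // => [|i].
  apply: eq_bigr => i _; rewrite -operator_scaleAr characterZ // chiT.
  by rewrite exprS mulrCA.
by rewrite -operator_scaleAr; apply: (subspaceZ _ sA).
Qed.

(** All characters vanish on T times the product of the T - chi(T), so this
    polynomial in T is nilpotent. *)
Lemma algebraic_common_kernel s k T :
  (forall chi, chi \in s -> character F chi) ->
  setpow (common_kernel F s) k `<=` [set 0] -> A T -> algebraic T.
Proof.
move=> ch nil AT; pose p := \prod_(chi <- s) ('X - (chi T)%:P).
exists (('X * p) ^+ k).
  rewrite expf_neq0 // mulf_neq0 ?polyX_eq0 // monic_neq0 //.
  exact: monic_prod_XsubC.
rewrite -/(op_horner T _) op_hornerXn; apply: nil; apply: setpow_exp.
split=> [|chi chis]; first exact: generated_horner.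
rewrite character_horner //; last exact: ch.
by rewrite /p (big_rem chi chis) /= hornerM hornerXsubC subrr mul0r mulr0.
Qed.

(** For a pair of distinct characters, cb - psi(b) c with psi(b) <> chi(b) and
    chi(c) <> 0 separates chi from psi; multiply over all psi. *)
Lemma character_interpolation s chi : uniq s ->
  (forall psi, psi \in s -> character F psi) -> chi \in s ->
  exists2 e, A e & forall psi, psi \in s -> psi e = (psi == chi)%:R.
Proof.
move=> us ch chis; have chi_ch := ch _ chis; have sA := subspace_generated F.
have sepa psi : character F psi -> psi != chi ->
    exists2 e, A e & chi e != 0 /\ psi e = 0.
  move=> chp /eqP psichi.
  have [b Ab bD] : exists2 b, A b & psi b != chi b.
    apply: contrapT => nob; apply: psichi; apply/funext => S.
    have [AS|nAS] := pselect (A S).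
      by apply: contrapT => /eqP Sne; apply: nob; exists S.
    by case: chp chi_ch => [_ _ -> // _] [_ _ -> //].
  have [c Ac chic] : exists2 c, A c & chi c != 0 by case: chi_ch.
  exists (c * b - psi b *: c).
    by apply: (subspaceB sA); [exact: generatedM|exact: (subspaceZ _ sA)].
  have Acb := generatedM Ac Ab; have Abc := subspaceZ (psi b) sA Ac.
  rewrite !characterB // !characterM // !characterZ //.
  split; last by rewrite mulrC subrr.
  by rewrite [X in X - _]mulrC -mulrBl mulf_neq0 // subr_eq0 eq_sym.
have [e Ae [chie ker]] : exists2 e, A e & chi e != 0 /\
    forall psi, psi \in s -> psi != chi -> psi e = 0.
  have : {subset s <= s} by [].
  elim: {-2}s => [_|psi r IH rs].
    by case: chi_ch => _ _ _ [c Ac chic]; exists c.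
  have [|e Ae [chie ker]] := IH.
    by move=> w wr; apply: rs; rewrite inE wr orbT.
  have [->|psichi] := eqVneq psi chi.
    exists e => //; split=> // w /[1!inE] /predU1P[->|]; last exact: ker.
    by rewrite eqxx.
  have psis := rs _ (mem_head _ _).
  have [f Af [chif psif]] := sepa psi (ch _ psis) psichi.
  exists (e * f); first exact: generatedM.
  split; first by rewrite characterM // mulf_neq0.
  move=> w wr wchi; rewrite characterM //; last exact/ch/rs.
  move: wr; rewrite inE => /predU1P[->|/ker->//]; last by rewrite mul0r.
  by rewrite psif mulr0.
exists ((chi e)^-1 *: e) => [|psi psis]; first exact: (subspaceZ _ sA).
rewrite characterZ //; last exact: ch.
by have [->|/ker->//] := eqVneq psi chi; rewrite ?mulVf // mulr0.
Qed.

Lemma quotient_iso s : uniq s -> (forall chi, chi \in s -> character F chi) ->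
  quotient_isomorphic_to_power A (common_kernel F s) (size s).
Proof.
move=> us ch; set J := common_kernel F s; have sA := subspace_generated F.
pose chi (i : 'I_(size s)) := nth (fun=> 0) s i.
have chi_s i : chi i \in s by rewrite mem_nth.
have chi_ch i : character F (chi i) by apply: ch.
have kerP S : A S -> (forall i, chi i S = 0) -> J S.
  move=> AS kS; split=> // psi psis.
  have := kS (Ordinal (etrans (index_mem psi s) psis)).
  by rewrite /chi /= nth_index.
have J0 : J 0 by apply: kerP => [|i]; [case: sA|exact: character0].
have coset_id T : coset J T T by exists 0; rewrite ?addr0.
have coset_val T S : A T -> coset J T S -> A S /\ forall i, chi i S = chi i T.
  move=> AT [U [AU kU] <-]; split; first exact: (subspaceD sA).
  by move=> i; rewrite characterD // kU ?addr0.
have coset_sub S T : A S -> A T -> (forall i, chi i S = chi i T) ->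
    coset J S `<=` coset J T.
  move=> AS AT ST _ [U [AU kU] <-].
  exists (S - T + U); last by rewrite addrA subrKC.
  have AB : A (S - T) by exact: (subspaceB sA).
  apply: kerP => [|i]; first exact: (subspaceD sA).
  by rewrite characterD // characterB // ST subrr kU ?addr0.
(* Any representative will do, since characters are constant on cosets; so f
   commutes with the setwise operations of the quotient. *)
pose f (X : set Op) := [ffun i => chi i (xget 0 X)].
have fE X T : X T -> (forall S, X S -> forall i, chi i S = chi i T) ->
    f X = [ffun i => chi i T].
  move=> XT XS; apply/ffunP => i; rewrite !ffunE; apply: XS.
  by apply: xgetPex; exists T.
have f_coset T : A T -> f (coset J T) = [ffun i => chi i T].
  by move=> AT; apply: fE => // S /(coset_val _ _ AT) [].
exists f; split.
- split=> [//|X Y|y _].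
    move=> /set_mem [S AS <-] /set_mem [T AT <-].
    rewrite !f_coset // => /ffunP ST.
    have {}ST i : chi i S = chi i T by have := ST i; rewrite !ffunE.
    by apply/seteqP; split; apply: coset_sub.
  have /choice [e He] :
      forall i, exists e, A e /\ forall j, chi j e = (j == i)%:R.
    move=> i; have [e Ae echi] := character_interpolation us ch (chi_s i).
    exists e; split=> // j; rewrite echi //; congr (nat_of_bool _)%:R.
    by rewrite /chi nth_uniq.
  have Ae i : A (y i *: e i) by apply: (subspaceZ _ sA); case: (He i).
  have Ay : A (\sum_i y i *: e i) by apply: (subspace_sum _ sA).
  exists (coset J (\sum_i y i *: e i)); first by exists (\sum_i y i *: e i).
  rewrite f_coset //; apply/ffunP => j; rewrite ffunE character_sum //.
  rewrite (bigD1 j) //= big1 ?addr0 => [|i ij].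
    by rewrite characterZ ?(He j).2 ?eqxx ?mulr1 //; case: (He j).
  rewrite characterZ ?(He i).2 1?eq_sym ?(negPf ij) ?mulr0 //.
  by case: (He i).
- move=> _ _ [S AS <-] [T AT <-]; rewrite !f_coset //.
  have AST : A (S + T) by exact: (subspaceD sA).
  rewrite (fE _ (S + T)).
  + by apply/ffunP => i; rewrite !ffunE characterD.
  + by exists S => //; exists T.
  move=> U [S' /(coset_val _ _ AS)[AS' S'S]] [T' /(coset_val _ _ AT)[AT' T'T]].
  move=> /(coset_val _ _ (subspaceD sA AS' AT'))[_ UE] i.
  by rewrite UE !characterD // S'S T'T.
- move=> c _ [S AS <-]; rewrite !f_coset //.
  rewrite (fE _ (c *: S)).
  + by apply/ffunP => i; rewrite !ffunE characterZ.
  + by exists S.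
  move=> U [S' /(coset_val _ _ AS)[AS' S'S]].
  move=> /(coset_val _ _ (subspaceZ c sA AS'))[_ UE] i.
  by rewrite UE !characterZ // S'S.
- move=> _ _ [S AS <-] [T AT <-]; rewrite !f_coset //.
  rewrite (fE _ (S * T)).
  + by apply/ffunP => i; rewrite !ffunE characterM.
  + by exists S => //; exists T.
  move=> U [S' /(coset_val _ _ AS)[AS' S'S]] [T' /(coset_val _ _ AT)[AT' T'T]].
  move=> /(coset_val _ _ (generatedM AS' AT'))[_ UE] i.
  by rewrite UE !characterM // S'S T'T.
Qed.

Lemma cofinite0_finite_dimensional :
  finite_set F -> cofinite F [set 0] -> finite_dimensional A.
Proof.
move=> finF [G [finG GU UG]].
have AE : A = span (setM F G).
  rewrite generatedE; apply/seteqP; split; last first.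
    by apply: span_mono => _ [S FS [T /GU UT <-]]; exists S => //; exists T.
  apply: span_min => [|_ [S FS [T /UG [g Gg Tg]] <-]].
    exact: subspace_span.
  have {Tg}-> : T = g by exact: subr0_eq.
  move: g Gg.
  suff: span G `<=` [set g | span (setM F G) (S * g)] by [].
  have sS := subspace_span (setM F G).
  apply: span_min => [|g Gg]; last by apply: sub_span; exists S => //; exists g.
  split=> [|c a b Sa Sb] /=; first by rewrite mulr0; case: sS.
  by rewrite mulrDr -operator_scaleAr; exact: sS.2.
have /finite_seqP [r rE] : finite_set (setM F G) by exact: finite_image2.
by exists (size r), (fun i => r`_i); rewrite AE rE span_seq.
Qed.

End Radical.

(** * L-nilpotent families *)

Section NilpotentLieFamily.
Variables (K : closedFieldType) (V : lmodType K) (F : set (operator V)).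
Local Notation Op := (operator V).
Implicit Types (T : Op) (Q : set Op).

Lemma algebraic_split T : algebraic T ->
  exists rs : seq K, \prod_(r <- rs) (T - r%:Op) = 0.
Proof.
move=> [p p0 pT]; have [rs pE] := closed_field_poly_normal p; exists rs.
move: pT; rewrite -/(op_horner T p) pE op_hornerZ op_horner_prodXsubC.
move=> /(congr1 ( *:%R (lead_coef p)^-1)).
by rewrite scaler0 scalerA mulVf ?lead_coef_eq0 // scale1r.
Qed.

Hypothesis char0 : [pchar K] =i pred0.
Hypothesis finF : finite_set F.
Hypothesis algF : forall T, F T -> algebraic T.

(** Induction on j: the first Lie power makes the generators central modulo Q,
    and each further one makes the previous one central. *)
Lemma tame_lie_power j Q : ideal F Q -> lie_power F j.+1 `<=` Q -> tame F Q.
Proof.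
elim: j Q => [|j IH] Q iQ FQ.
  have /finite_seqP [zs Fzs] := finF.
  apply: (@tame_adjoin_seq _ _ F setT zs) => // [z zzs|Q' iQ' QQ' lin].
    have Fz : F z by rewrite Fzs.
    have [rs zrs] := algebraic_split (algF Fz).
    split; [exact: gen_unital|exact: lie_power_central FQ Fz|].
    by exists rs => //; rewrite zrs; case: iQ => [[]].
  apply: tame_linear => // t; rewrite Fzs => /lin [r _ Qr]; by exists r.
have /finite_seqP [zs Fzs] := finite_lie_power j.+1 finF.
apply: (@tame_adjoin_seq _ _ F [set 0] zs) => // [z zzs|Q' iQ' QQ' lin].
  have Fz : lie_power F j.+1 z by rewrite Fzs.
  have cz := lie_power_central iQ FQ Fz.
  split=> //; first exact: lie_power_unital Fz.
  case: Fz cz => S FS [T FT <-] cz.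
  have US := lie_power_unital FS; have UT := gen_unital FT.
  have [m Qm] := commutator_nilpotent char0 iQ US UT cz (algF FT).
  exists (nseq m 0) => [r /nseqP []//|].
  rewrite big_nseq scale0r subr0 iter_mulr_1; exact: Qm.
apply: IH => // z; rewrite Fzs => /lin [_ ->].
by rewrite scale0r subr0.
Qed.

(** L-nilpotency starts the descent: some Lie power, hence the next, is 0. *)
Lemma tame0 : L_nilpotent F -> tame F [set 0].
Proof.
move=> [k Fk]; apply: (@tame_lie_power k) => [|_ [S FS [T _ <-]]].
  split=> [|a _ _ ->]; last by rewrite mulr0 mul0r.
  by split=> // c _ _ -> ->; rewrite /= scaler0 addr0.
have -> : S = 0 by move: FS; rewrite -/(lie_power F k) Fk.
by rewrite /commutator mul0r mulr0 subrr.
Qed.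

End NilpotentLieFamily.

Theorem corollary3p3 (R : realType) (V : lmodType (complex R))
    (F : set (operator V)) :
  finite_set F ->
  L_nilpotent F ->
  (forall T : operator V, F T -> algebraic T) ->
  let A := generated_algebra F in
  [/\ finite_dimensional A,
      (forall T : operator V, A T -> algebraic T),
      nilpotent (jacobson_radical A)
    & exists n : nat,
        quotient_isomorphic_to_power A (jacobson_radical A) n].
Proof.
move=> finF nilF algF A.
have char0 : [pchar (complex R)] =i pred0 by exact: Num.Theory.pchar_num.
have [cof [s ch [k nil]]] :=
  @tame0 [the closedFieldType of complex R] V F char0 finF algF nilF.
have us := undup_uniq s.
have {}ch chi : chi \in undup s -> character F chi.
  by rewrite mem_undup; exact: ch.
have {}nil : setpow (common_kernel F (undup s)) k `<=` [set 0].
  apply: subset_trans nil; apply: setpow_sub => S [AS kS]; split=> // chi.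
  by rewrite -mem_undup; exact: kS.
rewrite (jacobson_radicalE ch nil); split.
- exact: cofinite0_finite_dimensional.
- by move=> T; exact: algebraic_common_kernel ch nil.
- exact: setpow_nilpotent nil.
- by exists (size (undup s)); exact: quotient_iso.
Qed.
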